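(* Let $S$ be a semitopological inverse semigroup for which the inversion map $x\mapsto x'$ is continuous. If $T$ is an inverse subsemigroup of $S$ that admits a tight ideal series, then $T$ is closed in $S$.
   Context: All topological spaces are assumed Hausdorff. A semitopological semigroup is a semigroup equipped with a Hausdorff topology for which all left translations $x\mapsto sx$ and all right translations $x\mapsto xs$ are continuous. An inverse semigroup is a semigroup in which each element $x$ has a unique inverse $x'$, i.e. a unique element with $xx'x=x$ and $x'xx'=x'$; a semitopological inverse semigroup is a semitopological semigroup that is algebraically an inverse semigroup. An inverse subsemigroup is a subsemigroup closed under $x\mapsto x'$. An ideal of a semigroup $T$ is a nonempty subset $I\subseteq T$ with $TI\cup IT\subseteq I$. A subset $D$ of a semigroup $T$ is $\omega$-unstable if $D$ is infinite and for any $a\in D$ and any infinite subset $B\subseteq D$ we have $aB\cup Ba\not\subseteq D$. An ideal series for a semigroup $T$ is a chain of ideals $I_0\subseteq I_1\subseteq\cdots\subseteq I_m=T$ of $T$; it is tight if $I_0$ is a finite set and $I_k\setminus I_{k-1}$ is an $\omega$-unstable subset of $T$ for each $k=1,\ldots,m$. *)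

(* Defs.v *)
From HB Require Import structures.
From mathcomp Require Import all_boot.
From mathcomp Require Import boolp classical_sets functions cardinality topology.

Set Implicit Arguments.
Unset Strict Implicit.
Unset Printing Implicit Defensive.

Local Open Scope classical_set_scope.
Local Open Scope group_scope.

HB.structure Definition PreSemitopologicalSemigroup :=
  {S of Topological S & Semigroup S}.

HB.mixin Record PreSemitopologicalSemigroup_isSemitopological S
    of PreSemitopologicalSemigroup S := {
  semitop_hausdorff : hausdorff_space S;
  mul_continuousr : forall s : S, continuous (fun x : S => s * x);
  mul_continuousl : forall s : S, continuous (fun x : S => x * s)
}.

#[short(type="semitopologicalSemigroupType")]
HB.structure Definition SemitopologicalSemigroup :=
  {S of PreSemitopologicalSemigroup S
      & PreSemitopologicalSemigroup_isSemitopological S}.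

Definition inverse_of (S : magmaType) (x y : S) : Prop :=
  x * y * x = x /\ y * x * y = y.

(* The operation [sinv] carries no extra data: it is determined by the
   existence and uniqueness of inverses. *)
HB.mixin Record Semigroup_isInverseSemigroup S of Semigroup S := {
  sinv : S -> S;
  sinv_inverse : forall x : S, inverse_of x (sinv x);
  sinv_unique : forall x y : S, inverse_of x y -> y = sinv x
}.

#[short(type="inverseSemigroupType")]
HB.structure Definition InverseSemigroup :=
  {S of Semigroup S & Semigroup_isInverseSemigroup S}.

#[short(type="semitopologicalInverseSemigroupType")]
HB.structure Definition SemitopologicalInverseSemigroup :=
  {S of SemitopologicalSemigroup S & InverseSemigroup S}.

Definition subsemigroup (S : semigroupType) (T : set S) : Prop :=
  forall x y, T x -> T y -> T (x * y).

Definition inverse_subsemigroup (S : inverseSemigroupType) (T : set S) : Prop :=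
  subsemigroup T /\ (forall x, T x -> T (sinv x)).

(* In what follows the semigroup T is given as a subsemigroup of an ambient
   semigroup S, and subsets of T are sets of elements of S contained in T. *)

Definition ideal (S : semigroupType) (T I : set S) : Prop :=
  [/\ I !=set0, I `<=` T &
      [set t * i | t in T & i in I] `|` [set i * t | i in I & t in T] `<=` I].

Definition omega_unstable (S : semigroupType) (T D : set S) : Prop :=
  [/\ D `<=` T, infinite_set D &
      forall (a : S) (B : set S), D a -> B `<=` D -> infinite_set B ->
        ~ ([set a * b | b in B] `|` [set b * a | b in B] `<=` D)].

(* Only the terms I 0, ..., I m of the sequence I matter. *)
Definition ideal_series (S : semigroupType) (T : set S) (m : nat)
    (I : nat -> set S) : Prop :=
  [/\ forall k, (k <= m)%N -> ideal T (I k),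
      forall k, (k < m)%N -> I k `<=` I k.+1 &
      I m = T].

Definition tight_ideal_series (S : semigroupType) (T : set S) (m : nat)
    (I : nat -> set S) : Prop :=
  [/\ ideal_series T m I,
      finite_set (I 0%N) &
      forall k, (1 <= k <= m)%N -> omega_unstable T (I k `\` I k.-1)].

(* Main.v *)
Require Import Defs.
From mathcomp Require Import all_boot.
From mathcomp Require Import boolp classical_sets functions cardinality topology.

(** By induction, every term of the series is closed.  For ideals J of I with J
    closed and D = I \ J omega-unstable, suppose that y adheres to I but y is
    not in I.  Every neighbourhood of y contains infinitely many points of D,
    so instability and the closedness of J give a y \in J or y a \in J for each
    a in D.  If x adheres to I and x is not in I, then the same holds of x', so
    y = x' is allowed; letting a tend to x yields x x' \in J or x' x \in J,
    whence x = x x' x lies in J, which is absurd. *)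

Set Implicit Arguments.
Unset Strict Implicit.
Unset Printing Implicit Defensive.

Local Open Scope classical_set_scope.
Local Open Scope group_scope.

(** If [A] met [W] in a finite set, that set would be closed and miss [x]; deleting it from [W]
    would leave a neighbourhood of [x] disjoint from [A]. *)
Lemma infinite_nbhs_closure (X : topologicalType) (A W : set X) (x : X) :
  hausdorff_space X -> closure A x -> ~ A x -> nbhs x W ->
  infinite_set (A `&` W).
Proof.
move=> hX clx nAx Wx fin.
have cl : closed (A `&` W).
  exact: (accessible_finite_set_closed.1 (hausdorff_accessible hX)).
have nb : nbhs x (W `&` ~` (A `&` W)).
  apply: filterI => //; apply: open_nbhs_nbhs.
  by split; [exact: closed_openC | case].
by have [z [Az [Wz]]] := clx _ nb; apply.
Qed.

Lemma nbhs_preim_setC (X Y : topologicalType) (f : X -> Y) (J : set Y) (x : X) :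
  continuous f -> closed J -> ~ J (f x) -> nbhs x (f @^-1` ~` J).
Proof.
move=> fc clJ nJ; apply: fc; apply: open_nbhs_nbhs.
by split => //; exact: closed_openC.
Qed.

Lemma closure_closed_map (X Y : topologicalType) (f : X -> Y) (A : set X)
    (J : set Y) (x : X) :
  continuous f -> closed J -> (forall z, A z -> J (f z)) ->
  closure A x -> J (f x).
Proof.
move=> fc clJ AJ clx; apply: contrapT => nJ.
by have [z [/AJ Jz]] := clx _ (nbhs_preim_setC fc clJ nJ); apply.
Qed.

Lemma sinvK (S : inverseSemigroupType) : involutive (@sinv S).
Proof. by move=> x; have [e1 e2] := sinv_inverse x; apply/esym/sinv_unique. Qed.

Lemma idealMl (S : semigroupType) (T I : set S) (t i : S) :
  ideal T I -> T t -> I i -> I (t * i).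
Proof.
by move=> [_ _ sub] Tt Ii; apply: sub; left; exists t => //; exists i.
Qed.

Lemma idealMr (S : semigroupType) (T I : set S) (i t : S) :
  ideal T I -> I i -> T t -> I (i * t).
Proof.
by move=> [_ _ sub] Ii Tt; apply: sub; right; exists i => //; exists t.
Qed.

(** The identity i' = i' i i' places i' in T I T. *)
Lemma ideal_sinv (S : inverseSemigroupType) (T I : set S) (i : S) :
  inverse_subsemigroup T -> ideal T I -> I i -> I (sinv i).
Proof.
move=> [_ Tinv] idI Ii; have [_ IT _] := idI.
have Tj := Tinv _ (IT _ Ii); have [_ e] := sinv_inverse i; rewrite -e.
exact: (idealMr idI (idealMl idI Tj Ii) Tj).
Qed.

Lemma omega_unstable_closure (S : semitopologicalSemigroupType)
    (T I J : set S) (a y : S) :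
  ideal T I -> closed J -> J `<=` I -> omega_unstable T (I `\` J) ->
  (I `\` J) a -> closure I y -> ~ I y -> J (a * y) \/ J (y * a).
Proof.
move=> idI clJ JI [DT _ unst] Da cly nIy.
apply: contrapT => /not_orP[nl nr].
have Ta := DT _ Da.
(* Points of [W] avoid [J], and so do their products with [a] on either side. Hence the infinite set
   B = I ∩ W lies in I \ J together with a B and B a, which instability forbids. *)
pose W := ~` J `&` ((fun z => a * z) @^-1` (~` J) `&`
  (fun z => z * a) @^-1` (~` J)).
have Wy : nbhs y W.
  apply: filterI; last first.
    apply: filterI; apply: nbhs_preim_setC => //.
    - exact: mul_continuousr.
    - exact: mul_continuousl.
  by apply: open_nbhs_nbhs; split; [exact: closed_openC | move/JI].
have [_ IT _] := idI.
apply: (unst a (I `&` W)) => //.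
- by move=> z [Iz [nJz _]].
- exact: infinite_nbhs_closure (@semitop_hausdorff S) cly nIy Wy.
- move=> _ [[b [Ib [_ [nab nba]]] <-]|[b [Ib [_ [nab nba]]] <-]]; split => //.
  + exact: idealMl idI Ta Ib.
  + exact: idealMr idI Ib Ta.
Qed.

Lemma closed_ideal_step (S : semitopologicalInverseSemigroupType)
    (T I J : set S) :
  continuous (@sinv S) -> inverse_subsemigroup T ->
  ideal T I -> ideal T J -> J `<=` I -> closed J ->
  omega_unstable T (I `\` J) -> closed I.
Proof.
move=> invc Tinv idI idJ JI clJ unst x clx.
apply: contrapT => nIx; have nJx : ~ J x by move/JI.
have [_ IT _] := idI.
have cly : closure I (sinv x).
  apply: (closure_closed_map (f := @sinv S) (A := I)) clx => //.
    exact: closed_closure.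
  by move=> z Iz; apply: subset_closure; exact: ideal_sinv Tinv idI Iz.
have nIy : ~ I (sinv x).
  by move=> /(ideal_sinv Tinv idI); rewrite sinvK.
have [xE _] := sinv_inverse x.
(* As [x] need not lie in [T], the ideal property of [J] is applied to x x' z with z in [I], and the
   limit z → x then uses that [J] is closed. *)
have nr : ~ J (x * sinv x).
  move=> Jr; apply: nJx; rewrite -xE.
  apply: (closure_closed_map (f := fun z => x * sinv x * z) (A := I)) clx => //.
    exact: mul_continuousr.
  by move=> z /IT; exact: idealMr idJ Jr.
have nl : ~ J (sinv x * x).
  move=> Jl; apply: nJx; rewrite -xE -mulgA.
  apply: (closure_closed_map (f := fun z => z * (sinv x * x)) (A := I)) clx
    => //.
    exact: mul_continuousl.
  by move=> z /IT Tz; exact: idealMl idJ Tz Jl.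
(* Here x' stays fixed and only the other factor varies, so separate continuity suffices. A point
   [a] of [I] in this neighbourhood lies in I \ J, with a x' and x' a both outside [J]. *)
have Wx : nbhs x (~` J `&` ((fun z => z * sinv x) @^-1` (~` J) `&`
    (fun z => sinv x * z) @^-1` (~` J))).
  apply: filterI; last first.
    apply: filterI; apply: nbhs_preim_setC => //.
    - exact: mul_continuousl.
    - exact: mul_continuousr.
  by apply: open_nbhs_nbhs; split => //; exact: closed_openC.
have [a [Ia [nJa [nar nal]]]] := clx _ Wx.
by have [] := omega_unstable_closure idI clJ JI unst
  (conj Ia nJa) cly nIy.
Qed.

Theorem proposition10 (S : semitopologicalInverseSemigroupType)
    (inv_cont : continuous (@sinv S))
    (T : set S) (T_inverse : inverse_subsemigroup T)
    (T_tight : exists (m : nat) (I : nat -> set S), tight_ideal_series T m I) :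
  closed T.
Proof.
have [m [I [[idI subI ImT] fin0 unst]]] := T_tight.
(* The bound stays in the induction because the terms of [I] past [m] are arbitrary. *)
suff clI k : (k <= m)%N -> closed (I k) by rewrite -ImT; exact: clI.
elim: k => [_|k IHk lt_km].
  exact: (accessible_finite_set_closed.1
    (hausdorff_accessible (@semitop_hausdorff S))).
apply: (closed_ideal_step (T := T) (J := I k)) => //.
- exact: idI.
- exact/idI/ltnW.
- exact: subI.
- exact/IHk/ltnW.
- exact: (unst k.+1).
Qed.
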